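(* Let $M$ be the bilateral shift on $\ell^2(\mathbb{Z})$, i.e. the unitary operator determined by $M\mathbf{e}_n=\mathbf{e}_{n+1}$ for all $n\in\mathbb{Z}$, where $(\mathbf{e}_n)_{n\in\mathbb{Z}}$ is the standard orthonormal basis of $\ell^2(\mathbb{Z})$, and let $J$ be the conjugation $J\mathbf{x}=\overline{\mathbf{x}}$ (entrywise complex conjugation) on $\ell^2(\mathbb{Z})$. For a unitary operator $W$ on $\ell^2(\mathbb{Z})$, the following are equivalent. (a) $W\in\mathfrak{O}_c(M)$. (b) $W$ is a unitary shift with $W\mathbf{v}_j=\mathbf{v}_{j+1}$ for all $j\in\mathbb{Z}$, where $V=[\cdots|\mathbf{v}_{-1}|\mathbf{v}_0|\mathbf{v}_1|\cdots]$ is a doubly infinite unitary matrix (with columns $\mathbf{v}_j$, $j\in\mathbb{Z}$) satisfying $V^t=V$. Moreover, in this case $W=(VJ)M(VJ)$.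
   Context: A conjugation on a complex Hilbert space is an antilinear, isometric map $C$ with $C^2=I$. For a unitary operator $U$ on a complex Hilbert space $\mathcal{H}$, the conjugate orbit is $\mathfrak{O}_c(U)=\{CUC: C \text{ a conjugation on } \mathcal{H}\}$. A unitary operator $W$ on $\ell^2(\mathbb{Z})$ is called a unitary shift if there is an orthonormal basis $(\mathbf{v}_n)_{n\in\mathbb{Z}}$ of $\ell^2(\mathbb{Z})$ with $W\mathbf{v}_n=\mathbf{v}_{n+1}$ for each $n\in\mathbb{Z}$. A doubly infinite matrix $V=[V_{ij}]_{i,j\in\mathbb{Z}}$ is unitary if $\mathbf{x}\mapsto V\mathbf{x}$ is a unitary operator on $\ell^2(\mathbb{Z})$ (vectors viewed as columns); $V^t$ is its transpose; its $j$-th column is $\mathbf{v}_j=V\mathbf{e}_j$. *)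

(* Defs.v *)
From HB Require Import structures.
From mathcomp Require Export all_boot all_order all_algebra finmap.
From mathcomp Require Export all_classical all_reals all_analysis.
From mathcomp Require Export complex.
From mathcomp.analysis.showcase Require summability.
From mathcomp Require Import ring lra.
Export numFieldNormedType.Exports.

Set Implicit Arguments.
Unset Strict Implicit.
Unset Printing Implicit Defensive.
Import Order.TTheory GRing.Theory Num.Theory Normc.

Local Open Scope classical_set_scope.
Local Open Scope ring_scope.
Local Open Scope complex_scope.

Section SquareSummable.
Variable R : realType.

Definition square_summable : {pred int -> R[i]} :=
  [pred x : int -> R[i] | `[< summable setT (fun n => (normc (x n) ^+ 2)%:E) >]].

Lemma square_summableP (x : int -> R[i]) :
  reflect (\esum_(n in setT) (normc (x n) ^+ 2)%:E < +oo)%E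
          (x \in square_summable).
Proof.
have E : \esum_(n in setT) `|(normc (x n) ^+ 2)%:E|%E
       = \esum_(n in setT) (normc (x n) ^+ 2)%:E.
  by apply: eq_esum => n _; rewrite gee0_abs// lee_fin sqr_ge0.
by rewrite -E; exact: asboolP.
Qed.

Lemma square_summable_le (x y : int -> R[i]) (k : R) : 0 <= k ->
  (forall n, normc (x n) ^+ 2 <= k * normc (y n) ^+ 2) ->
  y \in square_summable -> x \in square_summable.
Proof.
move=> k0 xy /square_summableP y2; apply/square_summableP.
apply: (@le_lt_trans _ _ (k%:E * \esum_(n in setT) (normc (y n) ^+ 2)%:E)%E).
  apply: ge_ereal_sup => _ [A [Afin _] <-].
  apply: (@le_trans _ _ (k%:E * \sum_(i \in A) (normc (y i) ^+ 2)%:E)%E).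
    rewrite ge0_mule_fsumr; last by move=> i; rewrite lee_fin sqr_ge0.
    by apply: lee_fsum => // i _; rewrite -EFinM lee_fin.
  by rewrite lee_wpmul2l ?lee_fin//; apply: esum_ge; exists A.
by rewrite lte_mul_pinfty// ?esum_ge0// => n _; rewrite lee_fin sqr_ge0.
Qed.

Lemma normcD_le (a z : R[i]) :
  normc (a + z) ^+ 2 <= 2 * (normc a ^+ 2 + normc z ^+ 2).
Proof.
case: a z => [a b] [c d] /=; rewrite !sqr_sqrtr ?addr_ge0 ?sqr_ge0//.
have := sqr_ge0 (a - c); have := sqr_ge0 (b - d); nra.
Qed.

Lemma square_summable_submod : submod_closed square_summable.
Proof.
split.
  apply/square_summableP; rewrite esum1 ?ltry// => n _.
  by rewrite normc0 expr0n.
move=> a x y xS yS.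
have axS : a *: x \in square_summable.
  apply: (square_summable_le (sqr_ge0 (normc a)) _ xS) => n.
  by rewrite -exprMn -normcM.
have xyS : (\esum_(n in setT) ((normc ((a *: x) n) ^+ 2)%:E +
                               (normc (y n) ^+ 2)%:E) < +oo)%E.
  rewrite esumD; try by move=> n _; rewrite lee_fin sqr_ge0.
  by rewrite lte_add_pinfty//; exact/square_summableP.
apply/square_summableP.
pose z n := (Num.sqrt (normc ((a *: x) n) ^+ 2 + normc (y n) ^+ 2))%:C.
apply/square_summableP/(@square_summable_le _ z 2) => // [n|].
  rewrite /z /= [X in _ <= _ * X]sqr_sqrtr ?addr_ge0 ?sqr_ge0//.
  by rewrite expr0n addr0 sqr_sqrtr ?addr_ge0 ?sqr_ge0//; exact: normcD_le.
apply/square_summableP; congr (_ < _)%E : xyS; apply: eq_esum => n _.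
rewrite /z /= expr0n addr0 -EFinD; congr EFin.
by rewrite !sqr_sqrtr ?addr_ge0 ?sqr_ge0.
Qed.

HB.instance Definition _ :=
  GRing.isSubmodClosed.Build _ _ square_summable square_summable_submod.

Record l2 := L2 { l2val :> int -> R[i]; _ : l2val \in square_summable }.

HB.instance Definition _ := [isSub for l2val].
HB.instance Definition _ := [Choice of l2 by <:].
HB.instance Definition _ := [SubChoice_isSubLmodule of l2 by <:].

(* Sums over Z are unconditional sums (limits along the finite subsets of Z);
   R[i]^o carries the normed topology of the field R[i]. *)
Definition zsummable (z : int -> R[i]) : Prop :=
  cvg (summability.partial_sum (z : int -> R[i]^o) @ summability.totally).

Definition zsum (z : int -> R[i]) : R[i] := summability.sum (z : int -> R[i]^o).

Definition dot (x y : l2) : R[i] := zsum (fun n => x n * (y n)^*).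

Definition l2norm (x : l2) : R := Num.sqrt (complex.Re (dot x x)).

Lemma l2P (x y : l2) : (forall n, x n = y n) -> x = y.
Proof. by move=> xy; apply/val_inj/funext => n; exact: xy. Qed.

Lemma basis_subproof (j : int) :
  (fun n => (n == j)%:R) \in square_summable.
Proof.
apply/square_summableP; rewrite (esumID [set j])//; last first.
  by move=> n _; rewrite lee_fin sqr_ge0.
rewrite setTI [X in (_ + X)%E]esum1 ?adde0.
  by rewrite esum_set1 ?ltry// lee_fin sqr_ge0.
by move=> n [_ /= /eqP/negbTE ->]; rewrite normc0 expr0n.
Qed.

Definition basis (j : int) : l2 := L2 (basis_subproof j).

Lemma bilateral_shift_subproof (x : l2) :
  (fun n => x (n - 1)) \in square_summable.
Proof.
have /square_summableP := valP x; move=> xS; apply/square_summableP; move: xS.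
rewrite (reindex_esum setT setT (fun n : int => n - 1))//.
split=> // [m n _ _ /addIr //|n _].
by exists (n + 1); rewrite ?addrK.
Qed.

Definition bilateral_shift (x : l2) : l2 := L2 (bilateral_shift_subproof x).

Lemma bilateral_shift_basis n : bilateral_shift (basis n) = basis (n + 1).
Proof. by apply: l2P => m /=; rewrite subr_eq. Qed.

Lemma conj_l2_subproof (x : l2) : (fun n => (x n)^*) \in square_summable.
Proof.
apply: (square_summable_le ler01 _ (valP x)) => n /=.
by rewrite mul1r; case: (x n) => a b /=; rewrite sqrrN.
Qed.

Definition conj_l2 (x : l2) : l2 := L2 (conj_l2_subproof x).

(* A surjective linear isometry; preserving dot gives injectivity. *)
Definition unitary (U : l2 -> l2) : Prop :=
  [/\ linear U, (forall y, exists x, U x = y)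
     & forall x y, dot (U x) (U y) = dot x y].

Definition conjugation (C : l2 -> l2) : Prop :=
  [/\ forall a x y, C (a *: x + y) = a^* *: C x + C y,
      forall x, l2norm (C x) = l2norm x
    & forall x, C (C x) = x].

Definition conj_orbit (U : l2 -> l2) : set (l2 -> l2) :=
  [set C \o U \o C | C in conjugation].

(* An orthonormal family whose finite linear combinations are dense. *)
Definition orthonormal_basis (v : int -> l2) : Prop :=
  (forall m n, dot (v m) (v n) = (m == n)%:R) /\
  (forall (x : l2) (eps : R), 0 < eps ->
     exists (A : {fset int}) (c : int -> R[i]),
       l2norm (x - \sum_(n <- A) c n *: v n) < eps).

(* W is a unitary shift, v being an orthonormal basis that witnesses it. *)
Definition unitary_shift_along (v : int -> l2) (W : l2 -> l2) : Prop :=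
  [/\ unitary W, orthonormal_basis v & forall n, W (v n) = v (n + 1)].

Definition zmatrix := int -> int -> R[i].

Definition zmx_tr (V : zmatrix) : zmatrix := fun i j => V j i.

Definition zmx_mul (V : zmatrix) (x : l2) : int -> R[i] :=
  fun i => zsum (fun j => V i j * x j).

(* The junk value 0 is taken when zmx_mul V x is not square-summable;
   unitary_zmx rules this out. *)
Definition zmx_op (V : zmatrix) (x : l2) : l2 := insubd 0 (zmx_mul V x).

Definition unitary_zmx (V : zmatrix) : Prop :=
  [/\ forall (x : l2) i, zsummable (fun j => V i j * x j),
      forall x : l2, zmx_mul V x \in square_summable
    & unitary (zmx_op V)].

Definition zmx_col (V : zmatrix) (j : int) : l2 := zmx_op V (basis j).

Lemma zsum_delta (z : int -> R[i]) j : zsum (fun n => z n * (n == j)%:R) = z j.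
Proof.
have Ft := @summability.totally_filter int.
apply: (cvg_lim (@norm_hausdorff _ R[i]^o)); apply: cvg_near_cst.
exists [fset j]%fset => //= A jA.
rewrite /summability.partial_sum.
have jA' : j \in A by rewrite (fsubsetP jA)// inE.
rewrite (bigD1 [` jA']%fset)//= eqxx mulr1 big1 ?addr0// => i.
by rewrite -val_eqE /= => /negbTE ->; rewrite mulr0.
Qed.

Lemma zmx_colE (V : zmatrix) i j : unitary_zmx V -> zmx_col V j i = V i j.
Proof.
case=> _ VS _; rewrite /zmx_col /zmx_op -[l2val _]/(val _) insubdK ?VS//.
exact: zsum_delta.
Qed.

End SquareSummable.

(* Main.v *)
(* If W = C M C, then v_j := C e_j is an orthonormal basis shifted by W, and the
   matrix V with columns v_j satisfies V = C J. It is symmetric because C is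
   antiunitary and involutive:
     V i j = <C e_j, e_i> = <C e_j, C (C e_i)> = <C e_i, e_j> = V j i.
   Conversely, symmetry of V gives V J V e_i = e_i, so C := V J satisfies
   C^2 e_i = e_i; being antiunitary, C is then a conjugation. Finally W and
   C M C both map C e_j to C e_(j+1), hence coincide. *)

Require Import Defs.
From mathcomp Require Import ring.

Set Implicit Arguments.
Unset Strict Implicit.
Unset Printing Implicit Defensive.
Import Order.TTheory GRing.Theory Num.Theory Normc.

Local Open Scope classical_set_scope.
Local Open Scope ring_scope.
Local Notation "x %:C" := (real_complex _ x) (format "x %:C") : ring_scope.

(** * Unconditional sums over the integers *)

Section Zsum.
Variable R : realType.
Implicit Types (z w : int -> complex R) (k l m : complex R).

(** [zsum] is total, so an equation on it does not assert convergence; this relation carries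
    convergence together with the limit. *)
Definition zsum_to z l : Prop :=
  summability.partial_sum (z : int -> (complex R)^o) @ summability.totally
    --> (l : (complex R)^o).

Local Instance totally_filter_int :
  ProperFilter (@summability.totally int) :=
  @summability.totally_filter int.

Lemma zsum_toE z l : zsum_to z l -> zsum z = l.
Proof. by move=> zl; apply: (cvg_lim (@norm_hausdorff _ (complex R)^o)). Qed.

Lemma zsummableP z : zsummable z -> zsum_to z (zsum z).
Proof. by []. Qed.

Lemma zsum_to_summable z l : zsum_to z l -> zsummable z.
Proof. by move=> zl; apply/cvg_ex; exists l. Qed.

(** A positive element of [complex R] has zero imaginary part, so real tolerances suffice for the
    norm topology. *)
Lemma zsum_toP z l :
  zsum_to z l <-> forall e : R, 0 < e -> exists A : {fset int},
    forall B : {fset int}, (A `<=` B)%fset ->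
      normc (l - \sum_(i <- B) z i) < e.
Proof.
have E (B : {fset int}) :
    summability.partial_sum (z : int -> (complex R)^o) B = \sum_(i <- B) z i.
  by rewrite /summability.partial_sum big_seq_fsetE.
have N (x : complex R) : `|x| = (normc x)%:C by [].
split=> [zl e e0|H].
  have /cvgrPdist_lt/(_ e%:C) := zl; rewrite ltcR => /(_ e0)[A _ AB].
  by exists A => B /AB /=; rewrite E N ltcR.
apply/cvgrPdist_lt => e; rewrite ltcE /= => /andP[/eqP e1 e0].
have [A AB] := H _ e0; exists A => // B /= /AB Bl.
by rewrite E N ltcE /= e1 eqxx.
Qed.

Lemma zsum_toD z w l m : zsum_to z l -> zsum_to w m ->
  zsum_to (fun n => z n + w n) (l + m).
Proof.
move=> zl wm; apply: cvg_trans (cvgD zl wm); apply: near_eq_cvg.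
by apply: nearW => A; rewrite /summability.partial_sum big_split.
Qed.

Lemma zsum_toZ k z l : zsum_to z l -> zsum_to (fun n => k * z n) (k * l).
Proof.
move=> zl; apply: cvg_trans (cvgZl_tmp (k := k) zl); apply: near_eq_cvg.
by apply: nearW => A; rewrite /summability.partial_sum /= scaler_sumr.
Qed.

Lemma normc_conj (x : complex R) : normc (x^*) = normc x.
Proof. by case: x => a b /=; rewrite sqrrN. Qed.

Lemma zsum_to_conj z l : zsum_to z l -> zsum_to (fun n => (z n)^*) l^*.
Proof.
move/zsum_toP => zl; apply/zsum_toP => e /zl[A AB]; exists A => B /AB.
by rewrite -rmorph_sum -rmorphB normc_conj.
Qed.

Lemma mulr_conj (x : complex R) : x * x^* = (normc x ^+ 2)%:C.
Proof. by rewrite -sqr_normc rmorphXn. Qed.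

(** The terms are nonnegative, so the net of finite partial sums converges to its supremum, the
    extended-real sum, finite by square-summability. *)
Lemma square_zsum_to (x : l2 R) :
  exists2 l : R, 0 <= l & zsum_to (fun n => x n * (x n)^*) l%:C.
Proof.
have /square_summableP xS := valP x.
set s := (\esum_(n in _) _)%E in xS.
have s0 : (0 <= s)%E by apply: esum_ge0 => n _; rewrite lee_fin sqr_ge0.
have sfin : s \is a fin_num by rewrite ge0_fin_numE.
have sum_le (B : {fset int}) : \sum_(i <- B) normc (x i) ^+ 2 <= fine s.
  rewrite -lee_fin fineK// -sumEFin.
  apply: esum_ge; exists [set` B]; first by split => //; exact: finite_fset.
  by rewrite fsbig_finite ?finite_fset//= set_fsetK.
exists (fine s); first exact: fine_ge0.
apply/zsum_toP => e e0.
(* The partial sum over [A] already exceeds [s - e]; a larger finite set [B] only adds nonnegative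
   terms and stays below [s]. *)
have /ereal_sup_gt[_ [A [Afin _] <-]] : (s - e%:E < s)%E.
  by rewrite lteBlDr// lteDl// lte_fin.
rewrite fsbig_finite//= sumEFin -(fineK sfin) -EFinB lte_fin => Ae.
exists (fset_set A) => B AB.
rewrite (eq_bigr (fun n => (normc (x n) ^+ 2)%:C)); last first.
  by move=> n _; rewrite mulr_conj.
rewrite -rmorph_sum -rmorphB /= expr0n addr0 sqrtr_sqr ger0_norm ?subr_ge0//.
rewrite ltrBlDl -ltrBlDr (lt_le_trans Ae)//.
rewrite [leRHS](big_fsetID _ (mem (fset_set A)))/=.
have -> : [fset i in B | i \in mem (fset_set A)]%fset = fset_set A.
  apply/fsetP => i; rewrite !inE /=; apply/andP/idP => [[]//|iA].
  by split => //; apply: (fsubsetP AB).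
by rewrite lerDl sumr_ge0// => n _; rewrite sqr_ge0.
Qed.

End Zsum.

(** * The inner product and the standard basis *)

Section Dot.
Variable R : realType.
Implicit Types (x y z : l2 R) (a : complex R).

Lemma l2DE x y n : (x + y) n = x n + y n.
Proof. by []. Qed.

Lemma l2NE x n : (- x) n = - x n.
Proof. by []. Qed.

Lemma l2ZE a x n : (a *: x) n = a * x n.
Proof. by []. Qed.

(* Products are summable because, by polarization, they are combinations of
   four squares. *)
Lemma dot_zsum x y : zsum_to (fun n => x n * (y n)^*) (dot x y).
Proof.
pose sq z : complex R := zsum (fun n => z n * (z n)^*).
have sqP z : zsum_to (fun n => z n * (z n)^*) (sq z).
  by have [l _ zl] := square_zsum_to z; rewrite /sq (zsum_toE zl).
have i2 : 'i * 'i = -1 :> complex R by rewrite -expr2 sqrCi.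
have H := zsum_toZ (k := 4^-1)
  (zsum_toD (zsum_toD (sqP (x + y)) (zsum_toZ (k := -1) (sqP (x - y))))
    (zsum_toD (zsum_toZ (k := 'i) (sqP (x + 'i *: y)))
       (zsum_toZ (k := - 'i) (sqP (x - 'i *: y))))).
apply/zsummableP/zsum_to_summable.
move: H; congr zsum_to; apply/funext => n; cbv beta.
rewrite !(l2DE, l2NE, l2ZE); set p := x n; set q := y n.
rewrite !(rmorphD, rmorphB, rmorphM, rmorphN) /= !conjCi.
(* Polarization is now a polynomial identity in the independent variables [p], [q], [P], [Q], modulo
   [i2]. *)
set P := p^*; set Q := q^*.
have n4 : (4 : complex R) != 0 by rewrite pnatr_eq0.
by apply: (mulfI n4); rewrite mulVKf//; ring: i2.
Qed.

Arguments dot_zsum : clear implicits.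

Lemma conj_l2E x n : conj_l2 x n = (x n)^*.
Proof. by []. Qed.

Lemma dotC x y : dot y x = (dot x y)^*.
Proof.
apply: zsum_toE; have := zsum_to_conj (dot_zsum x y).
by congr zsum_to; apply/funext => n; rewrite rmorphM /= conjCK mulrC.
Qed.

Lemma dotDZl a x y z : dot (a *: x + y) z = a * dot x z + dot y z.
Proof.
apply: zsum_toE; have := zsum_toD (zsum_toZ (k := a) (dot_zsum x z)) (dot_zsum y z).
by congr zsum_to; apply/funext => n; rewrite mulrA -mulrDl.
Qed.

Lemma dot0l z : dot 0 z = 0.
Proof.
have /eqP := dotDZl 1 0 0 z.
by rewrite scale1r addr0 mul1r eq_sym -subr_eq0 addrK => /eqP.
Qed.

Lemma dotZl a x z : dot (a *: x) z = a * dot x z.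
Proof. by rewrite -[a *: x]addr0 dotDZl dot0l addr0. Qed.

Lemma dotDl x y z : dot (x + y) z = dot x z + dot y z.
Proof. by rewrite -[x]scale1r dotDZl mul1r scale1r. Qed.

Lemma dotBl x y z : dot (x - y) z = dot x z - dot y z.
Proof. by rewrite addrC -scaleN1r dotDZl mulN1r addrC. Qed.

Lemma dotBr x y z : dot z (x - y) = dot z x - dot z y.
Proof. by rewrite dotC dotBl rmorphB /= -!dotC. Qed.

Lemma dot_suml (s : seq int) (c : int -> (complex R)) (v : int -> l2 R) z :
  dot (\sum_(n <- s) c n *: v n) z = \sum_(n <- s) c n * dot (v n) z.
Proof.
rewrite (big_morph (fun x => dot x z) (fun x y => dotDl x y z) (dot0l z)).
by apply: eq_bigr => n _; rewrite dotZl.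
Qed.

Lemma dot_conj_l2 x y : dot (conj_l2 x) (conj_l2 y) = (dot x y)^*.
Proof.
apply: zsum_toE; have := zsum_to_conj (dot_zsum x y).
by congr zsum_to; apply/funext => n; rewrite rmorphM.
Qed.

Lemma dot_basis x j : dot x (basis R j) = x j.
Proof.
rewrite -[RHS]zsum_delta; congr zsum; apply/funext => n /=.
by rewrite conjC_nat.
Qed.

(** [l2norm] keeps only the real part of [dot x x]; nothing is lost, since a sum of squared moduli
    is real and nonnegative. *)
Lemma dot_sqr x : dot x x = (l2norm x ^+ 2)%:C.
Proof.
have [l l0 /zsum_toE xl] := square_zsum_to x.
by rewrite /l2norm [dot x x]xl /= sqr_sqrtr.
Qed.

Lemma dot_sqrDZ a x y : dot (a *: x + y) (a *: x + y) =
  a * a^* * dot x x + dot y y + (a * dot x y + (a * dot x y)^*).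
Proof.
rewrite dotDZl [dot x _]dotC [dot y _]dotC !dotDZl !(rmorphD, rmorphM) /= -!dotC.
by rewrite /= [dot y x]dotC; ring.
Qed.

Lemma conj_l2K : involutive (@conj_l2 R).
Proof. by move=> x; apply: l2P => n; rewrite !conj_l2E conjCK. Qed.

Lemma conj_l2_basis j : conj_l2 (basis R j) = basis R j.
Proof. by apply: l2P => n; rewrite conj_l2E conjC_nat. Qed.

Lemma conj_l2DZ a x y : conj_l2 (a *: x + y) = a^* *: conj_l2 x + conj_l2 y.
Proof.
by apply: l2P => n; rewrite !(conj_l2E, l2DE, l2ZE) rmorphD rmorphM.
Qed.

(** The residual of truncating [x] to [A] vanishes on [A], hence is orthogonal to the truncation;
    its square norm is therefore [dot x x] minus a partial sum of its series. *)
Lemma basis_dense x (eps : R) : 0 < eps -> exists A : {fset int},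
  l2norm (x - \sum_(n <- A) x n *: basis R n) < eps.
Proof.
move=> e0; have /zsum_toP/(_ (eps ^+ 2)) := dot_zsum x x.
rewrite exprn_gt0// => /(_ isT)[A /(_ A (fsubset_refl _))] xA; exists A.
set s := \sum_(n <- A) _; set y := x - s.
have yA n : n \in A -> y n = 0.
  move=> nA; rewrite -dot_basis dotBl dot_suml (big_fsetD1 n)//=.
  rewrite !dot_basis /= eqxx mulr1 big_seq big1 ?addr0 ?subrr// => m.
  by rewrite !inE dot_basis /= eq_sym => /andP[/negbTE -> _]; rewrite mulr0.
have yy : dot y y = dot x x - \sum_(n <- A) x n * (x n)^*.
  rewrite {1}/y dotBl dot_suml [X in _ - X]big_seq big1 ?subr0; last first.
    by move=> n nA; rewrite dotC dot_basis yA// conjC0 mulr0.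
  rewrite dotBr [dot x s]dotC dot_suml rmorph_sum; congr (_ - _).
  by apply: eq_bigr => n _; rewrite rmorphM /= -dotC dot_basis mulrC.
move: xA; rewrite -yy dot_sqr /= expr0n addr0 sqrtr_sqr ger0_norm ?sqr_ge0//.
by rewrite ltr_pXn2r ?nnegrE ?sqrtr_ge0 ?ltW.
Qed.

End Dot.

(** * Conjugations and symmetric unitary matrices *)

Section Conjugation.
Variable R : realType.
Implicit Types (x y : l2 R) (C : l2 R -> l2 R) (V : zmatrix R).

(* Polarization: compare the square norms of C (x + y) and C ('i *: x + y). *)
Lemma conjugation_dot C x y : conjugation C -> dot (C x) (C y) = (dot x y)^*.
Proof.
move=> [CL CI _].
have sq z : dot (C z) (C z) = dot z z by rewrite !dot_sqr CI.
have E a : a^* * dot (C x) (C y) + (a^* * dot (C x) (C y))^*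
         = a * dot x y + (a * dot x y)^*.
  have := sq (a *: x + y); rewrite CL !dot_sqrDZ !sq conjCK [a^* * a]mulrC.
  by move/addrI.
have := E 1; have := E 'i.
rewrite conjCi conjC1 !mul1r mulNr rmorphN !rmorphM /= !conjCi => Ei E1.
set p := dot _ _ in Ei E1 *; set q := dot x y in Ei E1 *.
(* [E1] equates the real parts of [p] and [q], and [Ei] makes their imaginary parts opposite; this
   combination isolates [p - q^*]. *)
have : 2 * 'i * (p - q^*) = 'i * (p + p^* - (q + q^*))
    - ((- ('i * p) - (- 'i * p^*)) - ('i * q + - 'i * q^*)) by ring.
rewrite E1 Ei !subrr mulr0 subrr => /eqP.
by rewrite !mulf_eq0 pnatr_eq0 (negbTE (neq0Ci _)) /= subr_eq0 => /eqP.
Qed.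

Section ConjugationMatrix.
Variables (C : l2 R -> l2 R) (hC : conjugation C).

Let V : zmatrix R := fun i j => C (basis R j) i.

Lemma conj_mx_tr : zmx_tr V = V.
Proof.
have [_ _ CK] := hC.
apply/funext => i; apply/funext => j; rewrite /zmx_tr /V -[LHS]dot_basis.
by rewrite -{1}[basis R j]CK conjugation_dot// -dotC dot_basis.
Qed.

(** With J = [conj_l2], <C J x, e_i> = <C J x, C (C e_i)> = <C e_i, J x>. By symmetry of [V], the
    series of this last product is row [i] applied to [x], so convergence and value come
    together. *)
Lemma conj_mx_zsum_to x i : zsum_to (fun j => V i j * x j) (C (conj_l2 x) i).
Proof.
have [_ _ CK] := hC.
rewrite -dot_basis -[basis R i]CK conjugation_dot// -dotC.
move: (@dot_zsum R (C (basis R i)) (conj_l2 x)).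
congr zsum_to; apply/funext => j.
by rewrite conj_l2E conjCK -[in RHS]conj_mx_tr.
Qed.

Lemma conj_mx_mulE x : zmx_mul V x = C (conj_l2 x).
Proof. by apply/funext => i; apply/zsum_toE/conj_mx_zsum_to. Qed.

Lemma conj_mx_opE : zmx_op V = C \o @conj_l2 R.
Proof.
apply/funext => x; apply/val_inj.
by rewrite /zmx_op conj_mx_mulE insubdK//; exact: valP.
Qed.

Lemma conj_mx_unitary : unitary_zmx V.
Proof.
have [CL _ CK] := hC.
split=> [x i|x|]; first by apply/zsum_to_summable; exact: conj_mx_zsum_to.
  by rewrite conj_mx_mulE; exact: valP.
rewrite conj_mx_opE; split=> [a x y|y|x y] /=.
- by rewrite conj_l2DZ CL conjCK.
- by exists (conj_l2 (C y)); rewrite conj_l2K CK.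
- by rewrite conjugation_dot// dot_conj_l2 conjCK.
Qed.

Lemma conj_mx_col j : zmx_col V j = C (basis R j).
Proof. by rewrite /zmx_col conj_mx_opE /= conj_l2_basis. Qed.

Lemma conjugation_sum (s : seq int) (c : int -> complex R) (v : int -> l2 R) :
  C (\sum_(n <- s) c n *: v n) = \sum_(n <- s) (c n)^* *: C (v n).
Proof.
have [CL _ _] := hC.
have C0 : C 0 = 0.
  by apply: (addrI (C 0)); rewrite addr0 -{1}[C 0]scale1r -conjC1 -CL scale1r addr0.
elim: s => [|n s IH]; first by rewrite !big_nil.
by rewrite !big_cons CL IH.
Qed.

Lemma conjugationB x y : C (x - y) = C x - C y.
Proof.
have [CL _ _] := hC.
by rewrite addrC -scaleN1r CL rmorphN /= conjC1 scaleN1r addrC.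
Qed.

Lemma conjugation_basis : orthonormal_basis (fun j => C (basis R j)).
Proof.
have [CL CI CK] := hC.
split=> [m n|x eps e0].
  by rewrite conjugation_dot// dot_basis /= conjC_nat eq_sym.
(* Approximate [C x] in the standard basis, then apply the isometry [C]; antilinearity conjugates
   the coefficients. *)
have [A AC] := basis_dense (C x) e0.
exists A, (fun n => (C x n)^*).
by rewrite -conjugation_sum -CI conjugationB CK.
Qed.

End ConjugationMatrix.

Lemma sym_unitary_conjugation V : unitary_zmx V -> zmx_tr V = V ->
  conjugation (zmx_op V \o @conj_l2 R).
Proof.
move=> VU Vsym; have [_ _ [UL Usurj Udot]] := VU.
set U := zmx_op V in UL Usurj Udot *.
(* The preimage [y] of e_i has coordinates y_k = <U y, U e_k> = <e_i, U e_k>, the conjugate of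
   [V i k]; by symmetry this is the [k]-th entry of J U e_i. *)
have UJU i : U (conj_l2 (U (basis R i))) = basis R i.
  have [y Uy] := Usurj (basis R i); rewrite -{2}Uy; congr U.
  apply: l2P => k; rewrite -[y k]dot_basis -Udot Uy dotC dot_basis.
  rewrite conj_l2E -/(zmx_col V i) -/(zmx_col V k) !zmx_colE//.
  by rewrite -[V k i]/(zmx_tr V i k) Vsym.
pose C := U \o @conj_l2 R.
have Cdot x y : dot (C x) (C y) = (dot x y)^* by rewrite /C Udot dot_conj_l2.
split=> [a x y|x|x]; rewrite -/C.
- by rewrite /C /= conj_l2DZ UL.
- by rewrite /l2norm Cdot; case: dot.
(* [UJU] says C (C e_i) = e_i. Antiunitarity used twice carries this to all [x]: <C C x, e_i> = <C C
   x, C C e_i> = <x, e_i>. *)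
- apply: l2P => i; rewrite -dot_basis.
  rewrite -{1}(UJU i) -{1}[basis R i]conj_l2_basis -[U (conj_l2 (U _))]/(C (C _)).
  by rewrite !Cdot conjCK dot_basis.
Qed.

(* Both sides are compared through their inner products with the C e_j, which
   avoids the continuity of W. *)
Lemma conjugation_shift_eq C (W : l2 R -> l2 R) : conjugation C -> unitary W ->
  (forall n, W (C (basis R n)) = C (basis R (n + 1))) ->
  W = C \o @bilateral_shift R \o C.
Proof.
move=> hC [_ _ Wdot] WC; have [_ _ CK] := hC.
apply/funext => x; rewrite -[W x]CK /=; congr (C _); apply: l2P => j.
rewrite -[RHS]/(C x (j - 1)) -[RHS]dot_basis -[LHS]dot_basis.
rewrite -[basis R j]CK -[basis R (j - 1)]CK !conjugation_dot//.
(* It remains to compare <W x, C e_j> with <x, C e_(j-1)>, and C e_j = W (C e_(j-1)). *)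
by rewrite -{1}[j](subrK 1) -WC Wdot.
Qed.

Lemma unitary_shift_eq V (W : l2 R -> l2 R) :
  [/\ unitary_zmx V, zmx_tr V = V & unitary_shift_along (zmx_col V) W] ->
  W = (zmx_op V \o @conj_l2 R) \o @bilateral_shift R
        \o (zmx_op V \o @conj_l2 R).
Proof.
move=> [VU Vsym [WU _ Wv]]; apply: conjugation_shift_eq => // [|n].
  exact: sym_unitary_conjugation.
by rewrite /= !conj_l2_basis; exact: Wv.
Qed.

End Conjugation.

Theorem theorem4p4 (R : realType) (W : l2 R -> l2 R) (hW : unitary W) :
  (conj_orbit (@bilateral_shift R) W <->
   exists V : zmatrix R,
     [/\ unitary_zmx V, zmx_tr V = V & unitary_shift_along (zmx_col V) W])
  /\
  (forall V : zmatrix R,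
     [/\ unitary_zmx V, zmx_tr V = V & unitary_shift_along (zmx_col V) W] ->
     W = (zmx_op V \o @conj_l2 R) \o @bilateral_shift R
           \o (zmx_op V \o @conj_l2 R)).
Proof.
split; last by move=> V hV; exact (unitary_shift_eq hV).
split=> [[C hC WE]|[V hV]]; last first.
  have [VU Vsym _] := hV.
  exists (zmx_op V \o @conj_l2 R); first exact: sym_unitary_conjugation.
  by rewrite [RHS](unitary_shift_eq hV).
have [_ _ CK] := hC.
exists (fun i j => C (basis R j) i); split.
- exact: conj_mx_unitary.
- exact: conj_mx_tr.
- split=> // [|n]; last first.
    by rewrite !conj_mx_col// -WE /= CK bilateral_shift_basis.
  have -> : zmx_col (fun i j => C (basis R j) i) = fun j => C (basis R j).
    by apply/funext => j; exact: conj_mx_col.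
  exact: conjugation_basis.
Qed.
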